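(* Let $p$ be a prime, let $a,c\in\mathbb{Q}_p$ with $ac\neq 0$ and $\sqrt{c^2-4a}\in\mathbb{Q}_p$, and let $f(x)=\frac{ax}{x^2+cx+a}$ for $x\in\mathbb{Q}_p\setminus\{\hat x_1,\hat x_2\}$, where $\hat x_{1,2}=\frac{-c\pm\sqrt{c^2-4a}}{2}$. Let $x_1=0$ and $x_2=-c$ be its fixed points, and put $\alpha=\min\{|\hat x_1|_p,|\hat x_2|_p\}$, $\beta=\max\{|\hat x_1|_p,|\hat x_2|_p\}$. Let $r\in\{p^m:m\in\mathbb{Z}\}$. Then: (1) The sphere $S_r(x_1)$ is invariant for $f$ if and only if $r<\alpha$. (2) The sphere $S_r(x_2)$ is invariant for $f$ if and only if one of the following holds: (a) $|c|_p<\alpha=\beta$ and $r<\alpha$; (b) $|c|_p=\alpha=\beta$, $|a-c^2|_p=\alpha^2$ and $r<\alpha$.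
   Context: $|\cdot|_p$ is the $p$-adic norm on $\mathbb{Q}_p$. For $s\in\mathbb{Q}_p$ and $r>0$, $S_r(s)=\{x\in\mathbb{Q}_p:|x-s|_p=r\}$. A sphere $S_r(s)$ is invariant for $f$ if for every $x\in S_r(s)$ all iterates $f^n(x)$, $n\geq 1$, are defined and belong to $S_r(s)$. *)

(* Defs.v *)
From HB Require Import structures.
From mathcomp Require Import all_boot all_order all_algebra generic_quotient.
From mathcomp Require Import ring_quotient.
From mathcomp Require Import boolp classical_sets functions.

Set Implicit Arguments.
Unset Strict Implicit.
Unset Printing Implicit Defensive.

Import Order.TTheory GRing.Theory Num.Theory.

Local Open Scope ring_scope.
Local Open Scope quotient_scope.

(* |q|_p = p ^ - v_p(q), with v_p(q) = logn p (numerator) - logn p (denominator).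
   As logn p vanishes when p is not prime, for such p this is the trivial
   absolute value; hence the constructions below need no hypothesis on p. *)
Definition padic_abs (p : nat) (q : rat) : rat :=
  if q == 0 then 0
  else p%:R ^ ((logn p `|denq q|%N)%:Z - (logn p `|numq q|%N)%:Z).

Section PadicAbs.
Variable p : nat.
Local Notation abs := (padic_abs p).

Lemma logn_nprime k : ~~ prime p -> logn p k = 0%N.
Proof. by move=> p_npr; rewrite lognE (negPf p_npr). Qed.

Lemma padic_abs0 : abs 0 = 0. Proof. by rewrite /padic_abs eqxx. Qed.

Lemma padic_abs_base (n : int) :
  n = 0 \/ (p%:R : rat) != 0 -> (p%:R : rat) ^ n > 0.
Proof.
case=> [->|p0]; first by rewrite expr0z.
by rewrite exprz_gt0 // lt_neqAle eq_sym p0 ler0n.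
Qed.

Lemma padic_abs_frac (n d : int) : n != 0 -> d != 0 ->
  abs (n%:~R / d%:~R)
  = p%:R ^ ((logn p `|d|%N)%:Z - (logn p `|n|%N)%:Z).
Proof.
move=> n0 d0; set q : rat := _ / _.
have q0 : q != 0 by rewrite mulf_neq0 ?invr_eq0 ?intr_eq0.
rewrite /padic_abs (negPf q0); congr (_ ^ _).
have E : numq q * d = n * denq q.
  apply: (@intr_inj rat); rewrite !rmorphM /=.
  have := divq_num_den q; rewrite {3}/q => /eqP.
  by rewrite eqr_div ?intr_eq0 ?denq_neq0 // => /eqP.
have /= := congr1 (fun z : int => logn p `|z|%N) E.
rewrite !abszM !lognM ?absz_gt0 ?numq_eq0 ?denq_neq0 // => /(congr1 Posz).
rewrite !PoszD => E2.
by apply/eqP; rewrite subr_eq addrAC eq_sym subr_eq addrC E2 addrC.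
Qed.

Lemma padic_abs_gt0 q : q != 0 -> 0 < abs q.
Proof.
move=> q0; rewrite /padic_abs (negPf q0); apply: padic_abs_base.
have [p_pr|p_npr] := boolP (prime p); last by left; rewrite !logn_nprime.
by right; rewrite pnatr_eq0 -lt0n prime_gt0.
Qed.

Lemma padic_abs_eq0 q : (abs q == 0) = (q == 0).
Proof.
apply/idP/idP => [|/eqP->]; last by rewrite padic_abs0.
by apply: contraTT => /padic_abs_gt0; rewrite lt0r => /andP[].
Qed.

Lemma padic_abs_ge0 q : 0 <= abs q.
Proof.
by have [->|/padic_abs_gt0/ltW//] := eqVneq q 0; rewrite padic_abs0.
Qed.

Lemma padic_absM x y : abs (x * y) = abs x * abs y.
Proof.
have [->|x0] := eqVneq x 0; first by rewrite mul0r padic_abs0 mul0r.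
have [->|y0] := eqVneq y 0; first by rewrite mulr0 padic_abs0 mulr0.
rewrite -{1}[x]divq_num_den -{1}[y]divq_num_den mulf_div -!rmorphM /=.
rewrite padic_abs_frac ?mulf_neq0 ?numq_eq0 ?denq_neq0 //.
rewrite !abszM !lognM ?absz_gt0 ?numq_eq0 ?denq_neq0 //.
rewrite /padic_abs (negPf x0) (negPf y0).
have [p_pr|p_npr] := boolP (prime p); last first.
  by rewrite !logn_nprime // subr0 expr0z mulr1.
have p0 := prime_gt0 p_pr.
rewrite -expfzDr ?pnatr_eq0 -?lt0n // !PoszD; congr (_ ^ _).
by rewrite opprD addrACA.
Qed.

Lemma padic_absN x : abs (- x) = abs x.
Proof. by rewrite /padic_abs oppr_eq0 denqN numqN abszN. Qed.

Lemma padic_abs1 : abs 1 = 1.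
Proof. by rewrite /padic_abs oner_eq0 /= /numq /denq /= logn1 expr0z. Qed.

Lemma padic_absV x : abs (x^-1) = (abs x)^-1.
Proof.
have [->|x0] := eqVneq x 0; first by rewrite invr0 padic_abs0.
apply: (mulfI (_ : abs x != 0)); first by rewrite padic_abs_eq0.
by rewrite -padic_absM !divff ?padic_abs1 ?padic_abs_eq0.
Qed.

Lemma padic_absD x y : abs (x + y) <= Num.max (abs x) (abs y).
Proof.
have [->|x0] := eqVneq x 0; first by rewrite add0r le_max lexx orbT.
have [->|y0] := eqVneq y 0; first by rewrite addr0 le_max lexx.
have [->|s0] := eqVneq (x + y) 0.
  by rewrite padic_abs0 le_max padic_abs_ge0.
have [p_pr|p_npr] := boolP (prime p); last first.
  by rewrite /padic_abs (negPf x0) (negPf y0) (negPf s0) !logn_nprime.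
pose b := denq x; pose d := denq y.
pose m := numq x * d; pose n := numq y * b.
have b0 : b != 0 by exact: denq_neq0.
have d0 : d != 0 by exact: denq_neq0.
have m0 : m != 0 by rewrite mulf_neq0 ?numq_eq0.
have n0 : n != 0 by rewrite mulf_neq0 ?numq_eq0.
have bd0 : b * d != 0 by rewrite mulf_neq0.
have Ex : x = m%:~R / (b * d)%:~R.
  by rewrite !rmorphM /= -mulf_div divff ?intr_eq0 // mulr1 divq_num_den.
have Ey : y = n%:~R / (b * d)%:~R.
  rewrite [b * d]mulrC !rmorphM /= -mulf_div divff ?intr_eq0 // mulr1.
  by rewrite divq_num_den.
have Es : x + y = (m + n)%:~R / (b * d)%:~R.
  by rewrite [in LHS]Ex [in LHS]Ey -mulrDl -rmorphD.
have mn0 : m + n != 0.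
  by apply: contraNneq s0 => mn0; rewrite Es mn0 mul0r.
rewrite Es [in X in Num.max X _]Ex [in X in Num.max _ X]Ey.
rewrite !padic_abs_frac //.
have p1 : (1 : rat) <= p%:R by rewrite (ler_nat _ 1) prime_gt0.
have H k : (k <= logn p `|m|%N)%N -> (k <= logn p `|n|%N)%N ->
    (k <= logn p `|(m + n)%R|%N)%N.
  rewrite -!pfactor_dvdn ?absz_gt0 //.
  have K z : (p ^ k %| `|z|)%N = ((p ^ k)%:Z %| z)%Z by rewrite dvdzE.
  by rewrite !K; exact: rpredD.
rewrite le_max; apply/orP.
case: (leqP (logn p `|m|%N) (logn p `|n|%N)) => [mn|/ltnW nm].
  by left; apply: ler_weXz2l => //; rewrite lerD2l lerN2 lez_nat H.
by right; apply: ler_weXz2l => //; rewrite lerD2l lerN2 lez_nat H.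
Qed.

Lemma padic_absB x y : abs (x - y) = abs (y - x).
Proof. by rewrite -padic_absN opprB. Qed.

Lemma padic_absD_lt x y e : abs x < e -> abs y < e -> abs (x + y) < e.
Proof.
by move=> xe ye; apply: le_lt_trans (padic_absD _ _) _; rewrite gt_max xe.
Qed.

Lemma padic_abs_close x y : abs (x - y) < abs y -> abs x = abs y.
Proof.
move=> xy; apply/eqP; rewrite eq_le; apply/andP; split.
  have := padic_absD (x - y) y; rewrite subrK => /le_trans; apply.
  by rewrite ge_max lexx ltW.
have := padic_absD (y - x) x; rewrite subrK le_max padic_absB.
by rewrite leNgt xy.
Qed.

End PadicAbs.

Definition padic_cauchy (p : nat) : {pred nat -> rat} := fun u =>
  `[< forall e : rat, 0 < e -> exists N : nat, forall m n : nat,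
      (N <= m)%N -> (N <= n)%N -> padic_abs p (u m - u n) < e >].

Lemma padic_cauchyP p u : reflect
  (forall e : rat, 0 < e -> exists N : nat, forall m n : nat,
      (N <= m)%N -> (N <= n)%N -> padic_abs p (u m - u n) < e)
  (u \in padic_cauchy p).
Proof. exact: asboolP. Qed.

Lemma padic_cauchy_bounded p u : u \in padic_cauchy p ->
  exists M, 0 < M /\ exists N, forall n, (N <= n)%N -> padic_abs p (u n) < M.
Proof.
move=> /padic_cauchyP/(_ 1 ltr01)[N HN].
exists (padic_abs p (u N) + 1); split.
  by rewrite ltr_wpDl ?padic_abs_ge0.
exists N => n Nn; rewrite -[u n](subrK (u N)); apply: padic_absD_lt.
  by apply: lt_le_trans (HN _ _ Nn (leqnn _)) _; rewrite lerDr padic_abs_ge0.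
by rewrite ltrDl.
Qed.

Lemma padic_cauchy_subring p : subring_closed (padic_cauchy p).
Proof.
split.
- apply/padic_cauchyP => e e0; exists 0%N => m n _ _.
  by rewrite subrr padic_abs0.
- move=> u v /padic_cauchyP Hu /padic_cauchyP Hv; apply/padic_cauchyP => e e0.
  have [N1 H1] := Hu e e0; have [N2 H2] := Hv e e0.
  exists (maxn N1 N2) => m n; rewrite !geq_max => /andP[m1 m2] /andP[n1 n2].
  have -> : (u - v) m - (u - v) n = (u m - u n) - (v m - v n).
    by rewrite !fctE /= opprD addrACA -opprD.
  by apply: padic_absD_lt; rewrite ?padic_absN; [exact: H1|exact: H2].
- move=> u v Cu Cv; apply/padic_cauchyP => e e0.
  have [A [A0 [N1 H1]]] := padic_cauchy_bounded Cu.
  have [B [B0 [N2 H2]]] := padic_cauchy_bounded Cv.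
  have [N3 H3] := padic_cauchyP _ _ Cu (e / B) (divr_gt0 e0 B0).
  have [N4 H4] := padic_cauchyP _ _ Cv (e / A) (divr_gt0 e0 A0).
  exists (maxn (maxn N1 N2) (maxn N3 N4)) => m n.
  rewrite !geq_max => /andP[/andP[m1 m2] /andP[m3 m4]].
  move=> /andP[/andP[n1 n2] /andP[n3 n4]].
  have -> : (u * v) m - (u * v) n = u m * (v m - v n) + (u m - u n) * v n.
    by rewrite mulrBr mulrBl addrA subrK.
  apply: padic_absD_lt; rewrite padic_absM.
    have /ltW/ler_wpM2r/le_lt_trans := H1 _ m1; apply.
      exact: padic_abs_ge0.
    by rewrite mulrC -ltr_pdivlMr //; exact: H4.
  have /ltW/ler_wpM2l/le_lt_trans := H2 _ n2; apply.
    exact: padic_abs_ge0.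
  by rewrite -ltr_pdivlMr //; exact: H3.
Qed.

HB.instance Definition _ p :=
  GRing.isSubringClosed.Build (nat -> rat) (padic_cauchy p)
    (padic_cauchy_subring p).

Record cauchyring (p : nat) :=
  CauchyRing { cauchyseq :> nat -> rat; _ : cauchyseq \in padic_cauchy p }.
HB.instance Definition _ p := [isSub for @cauchyseq p].
HB.instance Definition _ p := [Choice of cauchyring p by <:].
HB.instance Definition _ p :=
  [SubChoice_isSubComNzRing of cauchyring p by <:].

Definition padic_null (p : nat) : {pred cauchyring p} := fun u =>
  `[< forall e : rat, 0 < e -> exists N : nat, forall n : nat,
      (N <= n)%N -> padic_abs p (u n) < e >].

Lemma padic_nullP p (u : cauchyring p) : reflect
  (forall e : rat, 0 < e -> exists N : nat, forall n : nat,
      (N <= n)%N -> padic_abs p (u n) < e)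
  (u \in @padic_null p).
Proof. exact: asboolP. Qed.

Lemma padic_null_ideal p : idealr_closed (@padic_null p).
Proof.
split.
- by apply/padic_nullP => e e0; exists 0%N => n _; rewrite padic_abs0.
- apply/negP => /padic_nullP/(_ 1 ltr01)[N /(_ N (leqnn _))].
  by rewrite padic_abs1 ltxx.
- move=> a u v /padic_nullP Hu /padic_nullP Hv; apply/padic_nullP => e e0.
  have [A [A0 [N1 H1]]] := padic_cauchy_bounded (valP a).
  have [N2 H2] := Hu (e / A) (divr_gt0 e0 A0); have [N3 H3] := Hv e e0.
  exists (maxn N1 (maxn N2 N3)) => n; rewrite !geq_max => /and3P[n1 n2 n3].
  apply: (padic_absD_lt (x := a n * u n)); last exact: H3.
  rewrite padic_absM.
  have /ltW/ler_wpM2r/le_lt_trans := H1 _ n1; apply.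
    exact: padic_abs_ge0.
  by rewrite mulrC -ltr_pdivlMr //; exact: H2.
Qed.

HB.instance Definition _ p :=
  isIdealr.Build (cauchyring p) (@padic_null p) (@padic_null_ideal p).

(* The completion of rat for padic_abs: Cauchy sequences modulo null ones. *)
Definition Qp (p : nat) : Type := {ideal_quot (@padic_null p)}.
HB.instance Definition _ p := GRing.ComNzRing.on (Qp p).
HB.instance Definition _ p := Quotient.on (Qp p).

Lemma Qp_eq0 p (u : cauchyring p) :
  (\pi_(Qp p) u == 0) = (u \in @padic_null p).
Proof.
by rewrite -[0](rmorph0 (\pi_(Qp p))) -Quotient.idealrBE subr0.
Qed.

Lemma padic_nonnull p (u : cauchyring p) : u \notin @padic_null p ->
  exists c, 0 < c /\ exists N, forall n, (N <= n)%N -> padic_abs p (u n) = c.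
Proof.
move=> /padic_nullP/existsNP[e /not_implyP[e0 /forallNP He]].
have [N HN] := padic_cauchyP _ _ (valP u) e e0.
have /existsNP[k /not_implyP[Nk /negP]] := He N; rewrite -leNgt => ek.
exists (padic_abs p (u k)); split; first exact: lt_le_trans ek.
exists N => n Nn; apply: padic_abs_close; apply: lt_le_trans ek.
exact: HN.
Qed.

Lemma padic_cauchyV p (u : cauchyring p) : u \notin @padic_null p ->
  (fun n => (u n)^-1) \in padic_cauchy p.
Proof.
move=> /padic_nonnull[c [c0 [N HN]]]; apply/padic_cauchyP => e e0.
have [M HM] := padic_cauchyP _ _ (valP u) (e * c * c)
  (mulr_gt0 (mulr_gt0 e0 c0) c0).
exists (maxn N M) => m n; rewrite !geq_max => /andP[m1 m2] /andP[n1 n2].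
have u0 k : (N <= k)%N -> u k != 0.
  by move=> Nk; rewrite -(padic_abs_eq0 p) HN // gt_eqF.
have -> : (u m)^-1 - (u n)^-1 = (u n - u m) / u m / u n.
  by rewrite mulrBl divff ?u0 // mulrBl mul1r mulrAC divff ?u0 // mul1r.
by rewrite !padic_absM !padic_absV !HN // !ltr_pdivrMr // HM.
Qed.

Definition Qp_inv p (x : Qp p) : Qp p :=
  if x == 0 then 0
  else \pi_(Qp p) (insubd (0 : cauchyring p) (fun n => (repr x n)^-1)).

Lemma Qp_mulVf p (x : Qp p) : x != 0 -> Qp_inv x * x = 1.
Proof.
move=> x0; rewrite /Qp_inv (negPf x0).
have xN : repr x \notin @padic_null p by rewrite -Qp_eq0 reprK.
rewrite -[X in _ * X]reprK -rmorphM -[RHS](rmorph1 (\pi_(Qp p))).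
apply/eqP; rewrite -Quotient.idealrBE; apply/padic_nullP => e e0.
have [c [c0 [N HN]]] := padic_nonnull xN.
exists N => n Nn.
have -> : (insubd 0 (fun n => (repr x n)^-1) * repr x - 1 : cauchyring p) n
        = (repr x n)^-1 * repr x n - 1.
  have /(congr1 (fun v => v n * repr x n - 1)) :=
    insubdK (0 : cauchyring p) (padic_cauchyV xN).
  exact.
by rewrite mulVf ?subrr ?padic_abs0 // -(padic_abs_eq0 p) HN // gt_eqF.
Qed.

Lemma Qp_invr0 p : Qp_inv (0 : Qp p) = 0.
Proof. by rewrite /Qp_inv eqxx. Qed.

HB.instance Definition _ p :=
  GRing.ComNzRing_isField.Build (Qp p) (@Qp_mulVf p) (@Qp_invr0 p).

Definition seq_limit (a : nat -> rat) (l : rat) : Prop :=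
  forall e : rat, 0 < e -> exists N : nat, forall n : nat,
    (N <= n)%N -> `|a n - l| < e.

(* The limit of |u n|_p for any Cauchy sequence u representing x; Qp_normP and
   Qp_normE show that it exists and does not depend on u. It is a power of p
   or 0, so the norm takes its values in rat. *)
Definition Qp_norm (p : nat) (x : Qp p) : rat :=
  xget 0 (seq_limit (fun n => padic_abs p (repr x n)) : set rat).

Lemma seq_limit_unique a l l' : seq_limit a l -> seq_limit a l' -> l = l'.
Proof.
move=> H H'; apply/eqP; rewrite -subr_eq0 -normr_le0 leNgt; apply/negP => d0.
have [N HN] := H _ (divr_gt0 d0 (ltr0n _ 2)).
have [M HM] := H' _ (divr_gt0 d0 (ltr0n _ 2)).
have := ltrD (HN _ (leq_maxl N M)) (HM _ (leq_maxr N M)).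
rewrite -splitr distrC => /(le_lt_trans (ler_normD _ _)).
by rewrite addrA subrK distrC ltxx.
Qed.

Lemma Qp_norm_repr p (x : Qp p) :
  seq_limit (fun n => padic_abs p (repr x n)) (Qp_norm x).
Proof.
rewrite /Qp_norm; case: xgetP => [l -> //|/forallNP []].
have [x0|/padic_nonnull[c [_ [N HN]]]] := boolP (repr x \in @padic_null p).
  exists 0 => e e0; have [N HN] := padic_nullP _ x0 e e0.
  by exists N => n Nn; rewrite subr0 ger0_norm ?padic_abs_ge0 ?HN.
by exists c => e e0; exists N => n Nn; rewrite HN // subrr normr0.
Qed.

Lemma Qp_normP p (u : cauchyring p) :
  seq_limit (fun n => padic_abs p (u n)) (Qp_norm (\pi_(Qp p) u)).
Proof.
move=> e e0; set x := \pi_(Qp p) u.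
have /padic_nullP/(_ e e0)[N HN] : u - repr x \in @padic_null p.
  by rewrite Quotient.idealrBE; apply/eqP; exact: esym (reprK _).
have [M HM] := Qp_norm_repr x e0.
have [x0|/padic_nonnull[c [c0 [K HK]]]] := boolP (repr x \in @padic_null p).
  have [L HL] := padic_nullP _ x0 e e0.
  have -> : Qp_norm x = 0.
    apply: seq_limit_unique (Qp_norm_repr x) _ => d d0.
    have [J HJ] := padic_nullP _ x0 d d0.
    by exists J => n Jn; rewrite subr0 ger0_norm ?padic_abs_ge0 ?HJ.
  exists (maxn N L) => n; rewrite geq_max => /andP[Nn Ln].
  rewrite subr0 ger0_norm ?padic_abs_ge0 // -[u n](subrK (repr x n)).
  by apply: padic_absD_lt; [exact: HN|exact: HL].
have /padic_nullP/(_ c c0)[J HJ] : u - repr x \in @padic_null p.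
  by rewrite Quotient.idealrBE; apply/eqP; exact: esym (reprK _).
exists (maxn M (maxn K J)) => n; rewrite !geq_max => /and3P[Mn Kn Jn].
rewrite (_ : padic_abs p (u n) = padic_abs p (repr x n)); first exact: HM.
by apply: padic_abs_close; rewrite HK //; exact: HJ.
Qed.

Lemma Qp_normE p (u : cauchyring p) l :
  seq_limit (fun n => padic_abs p (u n)) l -> Qp_norm (\pi_(Qp p) u) = l.
Proof. exact: seq_limit_unique (Qp_normP u). Qed.

Lemma Qp_norm_eq0 p (x : Qp p) : (Qp_norm x == 0) = (x == 0).
Proof.
rewrite -[x]reprK Qp_eq0; apply/eqP/padic_nullP => [x0 e e0|x0].
  have [N HN] := Qp_normP (repr x) e0; exists N => n /HN.
  by rewrite x0 subr0 ger0_norm ?padic_abs_ge0.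
apply: Qp_normE => e e0; have [N HN] := x0 e e0.
by exists N => n Nn; rewrite subr0 ger0_norm ?padic_abs_ge0 ?HN.
Qed.

Lemma Qp_norm_eventually p (x : Qp p) : x != 0 ->
  exists N, forall n, (N <= n)%N -> padic_abs p (repr x n) = Qp_norm x.
Proof.
rewrite -{1}[x]reprK Qp_eq0 => /padic_nonnull[c [c0 [N HN]]].
exists N => n /HN ->; apply: seq_limit_unique (Qp_norm_repr x) => e e0.
by exists N => k /HN ->; rewrite subrr normr0.
Qed.

Lemma Qp_normM p (x y : Qp p) : Qp_norm (x * y) = Qp_norm x * Qp_norm y.
Proof.
have N0 : Qp_norm (0 : Qp p) = 0 by apply/eqP; rewrite Qp_norm_eq0.
have [->|x0] := eqVneq x 0; first by rewrite mul0r N0 mul0r.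
have [->|y0] := eqVneq y 0; first by rewrite mulr0 N0 mulr0.
have [N HN] := Qp_norm_eventually x0; have [M HM] := Qp_norm_eventually y0.
rewrite -{1}[x]reprK -{1}[y]reprK -rmorphM; apply: Qp_normE => e e0.
exists (maxn N M) => n; rewrite geq_max => /andP[Nn Mn].
by rewrite (padic_absM p (repr x n)) HN // HM // subrr normr0.
Qed.

Lemma Qp_normD p (x y : Qp p) :
  Qp_norm (x + y) <= Num.max (Qp_norm x) (Qp_norm y).
Proof.
rewrite leNgt gt_max; apply/negP => /andP[xs ys].
have E : \pi_(Qp p) (repr x + repr y) = x + y by rewrite rmorphD /= !reprK.
pose e := (Qp_norm (x + y) - Num.max (Qp_norm x) (Qp_norm y)) / 2%:R.
have e0 : 0 < e by rewrite divr_gt0 // subr_gt0 gt_max xs.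
have [N HN] := Qp_norm_repr x e0; have [M HM] := Qp_norm_repr y e0.
have := Qp_normP (repr x + repr y) e0; rewrite E => -[K HK].
pose n := maxn K (maxn N M).
have Kn : (K <= n)%N by rewrite leq_maxl.
have Nn : (N <= n)%N by rewrite /n maxnCA leq_maxl.
have Mn : (M <= n)%N by rewrite /n maxnA leq_maxr.
have := HN _ Nn; rewrite ltr_distl => /andP[_ Hx].
have := HM _ Mn; rewrite ltr_distl => /andP[_ Hy].
have := HK _ Kn; rewrite ltr_distl => /andP[Hs _].
have := lt_le_trans Hs (padic_absD p (repr x n) (repr y n)).
rewrite ltNge ge_max; apply/negP; rewrite negbK.
have S : Num.max (Qp_norm x) (Qp_norm y) + e = Qp_norm (x + y) - e.
  by apply/eqP; rewrite eq_sym subr_eq -addrA -splitr addrC subrK.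
rewrite -S; apply/andP; split.
  by apply: le_trans (ltW Hx) _; rewrite lerD2r le_max lexx.
by apply: le_trans (ltW Hy) _; rewrite lerD2r le_max lexx orbT.
Qed.

Lemma Qp_norm_nat p n : Qp_norm (n%:R : Qp p) = padic_abs p n%:R.
Proof.
rewrite -(rmorph_nat (\pi_(Qp p))); apply: Qp_normE => e e0.
exists 0%N => k _; have -> : (n%:R : cauchyring p) k = n%:R; last first.
  by rewrite subrr normr0.
by elim: n => [//|n IH]; rewrite !mulrS -IH.
Qed.

Section Dynamics.
Variable p : nat.

Definition sphere (r : rat) (s : Qp p) : set (Qp p) :=
  [set x | Qp_norm (x - s) = r]%classic.

(* Partial maps are option-valued; piter f n x = f^n(x), None if undefined. *)
Definition piter (f : Qp p -> option (Qp p)) (n : nat) (x : Qp p) :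
  option (Qp p) := iter n (obind f) (Some x).

Definition invariant_sphere (f : Qp p -> option (Qp p)) (r : rat) (s : Qp p) :=
  forall x, sphere r s x -> forall n : nat, (1 <= n)%N ->
    exists2 y, piter f n x = Some y & sphere r s y.

Definition ratmap (a c xh1 xh2 x : Qp p) : option (Qp p) :=
  if (x == xh1) || (x == xh2) then None
  else Some (a * x / (x ^+ 2 + c * x + a)).

End Dynamics.

(* Main.v *)
Require Import Defs.
From mathcomp Require Import all_boot all_order all_algebra.
From mathcomp Require Import ring.

Set Implicit Arguments.
Unset Strict Implicit.
Unset Printing Implicit Defensive.

Import Order.TTheory GRing.Theory Num.Theory.
Local Open Scope ring_scope.

(** Since [d] is a square root of [c ^+ 2 - 4 a], the poles [u], [v] satisfy
    [u * v = a] and [u + v = - c], so the denominator of [f] is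
    [(x - u) * (x - v)].  Around a fixed point [s] one can factor out the
    displacement [y]:
      [f (s + y) - s = y * g y / ((s + y - u) * (s + y - v))],
    with [g y = a] for [s = 0] and [g y = c * y + a - c ^+ 2] for [s = - c].
    Hence ([invariant_fixed_sphereP]) the sphere of radius [r] is invariant
    exactly when it contains no pole and [|g y| = |s + y - u| |s + y - v|]
    whenever [|y| = r]; iterates need no separate study, because the condition
    on one step propagates.

    Let [alpha <= beta] be the norms of the poles.  In both cases the two
    factors on the right are [y] plus or minus a pole, because
    [- c - u = v] and [- c - v = u].  So a pole lies on the sphere when [r] is
    [alpha] or [beta], and otherwise the isosceles property of the ultrametric
    ([Qp_normD_ltl], [Qp_normD_ltr]) gives the right-hand side: [alpha beta],
    [r beta] or [r ^+ 2] according to whether [r < alpha], [alpha < r < beta]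
    or [beta < r].  For [s = 0] the left-hand side is always [alpha beta],
    which leaves only [r < alpha].

    For [s = - c], [|c| <= beta], with equality if [alpha < beta].
    If [beta < r] the left-hand side is smaller than [r ^+ 2].  If
    [alpha < beta] and [r < beta] the term [c ^+ 2] dominates, the left-hand
    side is [beta ^+ 2] and it exceeds the right-hand side.  There remains
    [r < alpha = beta], where [|c * y| < alpha ^+ 2] and the condition becomes
    [|a - c ^+ 2| = alpha ^+ 2]; this is automatic when [|c| < alpha]. *)

(** * The ultrametric norm on the p-adic numbers *)

Section Norm.
Variable p : nat.
Implicit Types x y : Qp p.

Lemma Qp_norm0 : Qp_norm (0 : Qp p) = 0.
Proof. by apply/eqP; rewrite Qp_norm_eq0. Qed.

Lemma Qp_norm1 : Qp_norm (1 : Qp p) = 1.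
Proof. by rewrite (Qp_norm_nat p 1) padic_abs1. Qed.

Lemma Qp_norm_ge0 x : 0 <= Qp_norm x.
Proof.
have [->|x0] := eqVneq x 0; first by rewrite Qp_norm0.
by have [N /(_ N (leqnn N)) <-] := Qp_norm_eventually x0;
  rewrite padic_abs_ge0.
Qed.

Lemma Qp_norm_gt0 x : (0 < Qp_norm x) = (x != 0).
Proof. by rewrite lt_def Qp_norm_eq0 Qp_norm_ge0 andbT. Qed.

Lemma Qp_normN x : Qp_norm (- x) = Qp_norm x.
Proof.
suff N1 : Qp_norm (-1 : Qp p) = 1 by rewrite -mulN1r Qp_normM N1 mul1r.
apply/eqP; rewrite -(@sqrp_eq1 rat) ?Qp_norm_ge0 //.
by rewrite expr2 -Qp_normM mulrNN mulr1 Qp_norm1.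
Qed.

Lemma Qp_normV x : Qp_norm x^-1 = (Qp_norm x)^-1.
Proof.
have [->|x0] := eqVneq x 0; first by rewrite !invr0 Qp_norm0 invr0.
apply: (@mulfI _ (Qp_norm x)); first by rewrite Qp_norm_eq0.
by rewrite -Qp_normM !divff ?Qp_norm1 ?Qp_norm_eq0.
Qed.

(** If the sum were shorter than [y], then [y], the difference of the sum and
    [x], would be shorter than itself. *)
Lemma Qp_normD_ltl x y : Qp_norm x < Qp_norm y -> Qp_norm (x + y) = Qp_norm y.
Proof.
move=> xy; apply/eqP; rewrite eq_le; apply/andP; split.
  by apply: le_trans (Qp_normD _ _) _; rewrite ge_max lexx ltW.
have := Qp_normD (x + y) (- x).
by rewrite addrAC subrr add0r Qp_normN le_max [_ y <= _ x]leNgt xy orbF.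
Qed.

Lemma Qp_normD_ltr x y : Qp_norm y < Qp_norm x -> Qp_norm (x + y) = Qp_norm x.
Proof. by rewrite addrC; exact: Qp_normD_ltl. Qed.

Lemma Qp_normD_lt x y (e : rat) :
  Qp_norm x < e -> Qp_norm y < e -> Qp_norm (x + y) < e.
Proof.
by move=> xe ye; apply: le_lt_trans (Qp_normD _ _) _; rewrite gt_max xe.
Qed.

Lemma Qp_natr_eq0 n : (n%:R == 0 :> Qp p) = (n == 0%N).
Proof. by rewrite -Qp_norm_eq0 Qp_norm_nat padic_abs_eq0 pnatr_eq0. Qed.

Lemma Qp_norm_prime : prime p -> Qp_norm (p%:R : Qp p) = p%:R^-1.
Proof.
move=> p_pr; have p0 : (p%:Z != 0) by rewrite eqz_nat -lt0n prime_gt0.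
have := @padic_abs_frac p p%:Z 1 p0 isT.
rewrite divr1 -pmulrn Qp_norm_nat => ->.
by rewrite absz1 logn1 logn_prime // eqxx sub0r exprN1.
Qed.

Lemma Qp_norm_prime_exp (m : int) :
  prime p -> exists y : Qp p, Qp_norm y = p%:R ^ m.
Proof.
move=> p_pr; have normX (x : Qp p) n : Qp_norm (x ^+ n) = Qp_norm x ^+ n.
  by elim: n => [|n IH]; rewrite ?expr0 ?Qp_norm1 // !exprS Qp_normM IH.
case: m => n; last first.
  by exists (p%:R ^+ n.+1); rewrite normX Qp_norm_prime // exprVn.
by exists (p%:R ^- n); rewrite Qp_normV normX Qp_norm_prime // exprVn invrK.
Qed.

End Norm.

(** * Spheres around a fixed point *)

Section FixedPoint.
Variable p : nat.
Implicit Types (f : Qp p -> option (Qp p)) (a c u v s x y : Qp p) (r : rat).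

Lemma invariant_sphereP f r s :
  invariant_sphere f r s <->
  forall x, sphere r s x -> exists2 y, f x = Some y & sphere r s y.
Proof.
split=> [inv x sx|step x sx n _]; first exact: (inv x sx 1%N).
elim: n => [|n [y fy /step[z fz sz]]]; first by exists x.
by exists z; rewrite // /piter iterS -/(piter f n x) fy.
Qed.

(** The displacement [y] is a factor of [f (s + y) - s] because [s] is fixed;
    cancelling [|y| = r] on both sides turns [|f (s + y) - s| = r] into an
    equality between the remaining factors. *)
Lemma invariant_fixed_sphereP a c u v s (g : Qp p -> Qp p) r : 0 < r ->
  (forall y, s + y != u -> s + y != v ->
     a * (s + y) / ((s + y) ^+ 2 + c * (s + y) + a) - s
     = y * g y / ((s + y - u) * (s + y - v))) ->
  invariant_sphere (ratmap a c u v) r s <->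
  forall y, Qp_norm y = r ->
    [/\ s + y != u, s + y != v &
        Qp_norm (g y) = Qp_norm (s + y - u) * Qp_norm (s + y - v)].
Proof.
move=> r0 fE; rewrite invariant_sphereP.
have normE y : s + y != u -> s + y != v -> Qp_norm y = r ->
    (Qp_norm (a * (s + y) / ((s + y) ^+ 2 + c * (s + y) + a) - s) == r) =
    (Qp_norm (g y) == Qp_norm (s + y - u) * Qp_norm (s + y - v)).
  move=> yu yv yr; rewrite fE // !Qp_normM Qp_normV Qp_normM yr.
  rewrite -mulrA -[X in _ == X]mulr1 (inj_eq (mulfI (lt0r_neq0 r0))).
  have D0 : Qp_norm (s + y - u) * Qp_norm (s + y - v) != 0.
    by rewrite mulf_neq0 // Qp_norm_eq0 subr_eq0.
  by rewrite -(inj_eq (mulIf D0)) divfK // mul1r.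
split=> [inv y yr|inv x sx].
  have [|z] := inv (s + y); first by rewrite /sphere /= addrAC subrr add0r.
  rewrite /ratmap; case: ifP => // /negbT; rewrite negb_or => /andP[yu yv] [<-].
  by move=> /eqP; rewrite normE // => /eqP.
have [] := inv (x - s) sx; rewrite addrC subrK => xu xv gE.
rewrite /ratmap (negPf xu) (negPf xv); eexists; first by [].
apply/eqP; have := normE (x - s); rewrite [s + (x - s)]addrC subrK.
by move=> /(_ xu xv sx) ->; rewrite gE.
Qed.

Lemma ratmap_swap a c u v : ratmap a c u v = ratmap a c v u.
Proof. by apply: boolp.funext => x; rewrite /ratmap orbC. Qed.

End FixedPoint.

Lemma displacement_at_0 (F : fieldType) (u v y : F) :
  u * v * y / (y ^+ 2 + - (u + v) * y + u * v) - 0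
  = y * (u * v) / ((y - u) * (y - v)).
Proof.
rewrite subr0 [y * (u * v)]mulrC; congr (_ / _); ring.
Qed.

(** With [u] and [v] as poles, the fixed point [- c] is [u + v], so that each
    pole is displaced from it by the opposite of the other one. *)
Lemma displacement_at_uv (F : fieldType) (u v y : F) :
  u + v + y != u -> u + v + y != v ->
  u * v * (u + v + y) / ((u + v + y) ^+ 2 + - (u + v) * (u + v + y) + u * v)
    - (u + v)
  = y * (- (u + v) * y + (u * v - (u + v) ^+ 2))
    / ((u + v + y - u) * (u + v + y - v)).
Proof.
rewrite -(subr_eq0 _ u) -(subr_eq0 _ v) => yu yv.
have D0 : (u + v + y - u) * (u + v + y - v) != 0 by rewrite mulf_neq0.
have -> : (u + v + y) ^+ 2 + - (u + v) * (u + v + y) + u * v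
  = (u + v + y - u) * (u + v + y - v) by ring.
apply: (mulIf D0); rewrite mulrBl !divfK //; ring.
Qed.

(** * The two fixed points *)

Section Spheres.
Variables (p : nat) (p_prime : prime p) (u v : Qp p) (r : rat).
Hypotheses (u0 : u != 0) (uv : Qp_norm u <= Qp_norm v).
Hypothesis r_pow : exists m : int, r = p%:R ^ m.
Let f := ratmap (u * v) (- (u + v)) u v.

Let r_gt0 : 0 < r.
Proof.
by case: r_pow => m ->; rewrite exprz_gt0 // ltr0n prime_gt0.
Qed.

Let exists_norm_r : exists y : Qp p, Qp_norm y = r.
Proof. by case: r_pow => m ->; exact: Qp_norm_prime_exp. Qed.

Let u_gt0 : 0 < Qp_norm u. Proof. by rewrite Qp_norm_gt0. Qed.
Let v_gt0 : 0 < Qp_norm v. Proof. exact: lt_le_trans uv. Qed.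

Lemma invariant_sphere_0 : invariant_sphere f r 0 <-> r < Qp_norm u.
Proof.
rewrite (invariant_fixed_sphereP (g := fun=> u * v)) //; last first.
  by move=> y _ _; rewrite add0r; exact: displacement_at_0.
split=> [inv|ru y yr]; last first.
  have rv := lt_le_trans ru uv; rewrite add0r Qp_normM; split.
  - by apply: contraTneq ru => <-; rewrite yr ltxx.
  - by apply: contraTneq rv => <-; rewrite yr ltxx.
  - by rewrite !Qp_normD_ltl ?Qp_normN ?yr.
have [y yr] := exists_norm_r.
have ru : r != Qp_norm u.
  by apply/eqP => ru; have [] := inv u (esym ru); rewrite add0r eqxx.
have rv : r != Qp_norm v.
  by apply/eqP => rv; have [] := inv v (esym rv); rewrite add0r eqxx.
have [_ _] := inv y yr; rewrite add0r Qp_normM.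
case: ltgtP ru => // ur _.
rewrite [Qp_norm (y - u)]Qp_normD_ltr ?Qp_normN ?yr //.
case: ltgtP rv => // rv _; last first.
  rewrite Qp_normD_ltr ?Qp_normN ?yr // => /eqP; rewrite lt_eqF //.
  by rewrite ltr_pM // ltW.
rewrite Qp_normD_ltl ?Qp_normN ?yr // => /eqP.
by rewrite lt_eqF // ltr_pM2r.
Qed.

Lemma invariant_sphere_uv :
  invariant_sphere f r (u + v) <->
  [/\ r < Qp_norm u, Qp_norm u = Qp_norm v &
      Qp_norm (u * v - (u + v) ^+ 2) = Qp_norm u ^+ 2].
Proof.
pose g y := - (u + v) * y + (u * v - (u + v) ^+ 2).
rewrite (invariant_fixed_sphereP (g := g)) //; last first.
  by move=> y; exact: displacement_at_uv.
have shift_u y : u + v + y - u = y + v by ring.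
have shift_v y : u + v + y - v = y + u by ring.
have norm_uv : Qp_norm (u + v) <= Qp_norm v.
  by apply: le_trans (Qp_normD _ _) _; rewrite ge_max uv lexx.
split=> [inv|[ru uvE gE] y yr]; last first.
  have rv : r < Qp_norm v by rewrite -uvE.
  have yu : Qp_norm (y + u) = Qp_norm u by rewrite Qp_normD_ltl ?yr.
  have yv : Qp_norm (y + v) = Qp_norm u by rewrite uvE Qp_normD_ltl ?yr.
  rewrite -(subr_eq0 _ u) -(subr_eq0 _ v) shift_u shift_v -!Qp_norm_eq0.
  rewrite yu yv gt_eqF //; split=> //.
  rewrite /g Qp_normD_ltl gE ?expr2 // Qp_normM Qp_normN yr.
  apply: le_lt_trans (_ : Qp_norm u * r < _); last by rewrite ltr_pM2l.
  by rewrite ler_pM2r // uvE.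
have [y yr] := exists_norm_r.
have ru : r != Qp_norm u.
  apply/eqP => ru; have [|_ /eqP[]] := inv (- u); first by rewrite Qp_normN.
  by rewrite addrAC subrr add0r.
have rv : r != Qp_norm v.
  apply/eqP => rv; have [|/eqP[]] := inv (- v); first by rewrite Qp_normN.
  by rewrite addrK.
have [_ _] := inv y yr; rewrite shift_u shift_v /g => gE.
have uv_sqr : Qp_norm (u + v) * Qp_norm (u + v) <= Qp_norm v * Qp_norm v.
  by rewrite ler_pM ?Qp_norm_ge0.
(* Beyond both poles the right-hand side is [r ^+ 2], and each term of [g y]
   is smaller. *)
have {rv} rv : r < Qp_norm v.
  case: ltgtP rv => // vr _.
  have ur := le_lt_trans uv vr.
  move: gE; rewrite [Qp_norm (y + v)]Qp_normD_ltr ?yr //.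
  rewrite [Qp_norm (y + u)]Qp_normD_ltr ?yr //.
  move/eqP; rewrite lt_eqF //.
  apply: Qp_normD_lt.
    by rewrite Qp_normM Qp_normN yr ltr_pM2r //; exact: le_lt_trans vr.
  apply: Qp_normD_lt; first by rewrite Qp_normM ltr_pM // ltW.
  rewrite Qp_normN expr2 Qp_normM; apply: le_lt_trans uv_sqr _.
  by rewrite ltr_pM // ltW.
move: gE; rewrite [Qp_norm (y + v)]Qp_normD_ltl ?yr // => gE.
have cy_lt : Qp_norm (- (u + v) * y) < Qp_norm v * Qp_norm v.
  rewrite Qp_normM Qp_normN yr.
  by apply: le_lt_trans (_ : Qp_norm v * r < _); rewrite ?ler_pM2r ?ltr_pM2l.
(* If the poles had different norms, [(u + v) ^+ 2] would dominate [g y]. *)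
have uvE : Qp_norm u = Qp_norm v.
  move: uv; rewrite le_eqVlt => /predU1P[//|uv_lt].
  have c_norm : Qp_norm (u + v) = Qp_norm v by rewrite Qp_normD_ltl.
  have const_norm : Qp_norm (u * v - (u + v) ^+ 2) = Qp_norm v * Qp_norm v.
    have c_sqr : Qp_norm (- (u + v) ^+ 2) = Qp_norm v * Qp_norm v.
      by rewrite Qp_normN expr2 Qp_normM c_norm.
    by rewrite Qp_normD_ltl c_sqr // Qp_normM ltr_pM2r.
  move: gE; rewrite [Qp_norm (_ * y + _)]Qp_normD_ltl const_norm // => /eqP.
  by rewrite gt_eqF // ltr_pM2l //; apply: Qp_normD_lt; rewrite ?yr.
have {}ru : r < Qp_norm u by rewrite uvE.
split=> //; move: gE; rewrite [Qp_norm (y + u)]Qp_normD_ltl ?yr // uvE => gE.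
rewrite [RHS]expr2 -[u * v - _](addKr (- (u + v) * y)).
by rewrite Qp_normD_ltl gE // Qp_normN.
Qed.

End Spheres.

(* d is a square root of c^2 - 4a in Q_p. *)
Theorem corollary1 (p : nat) (p_prime : prime p) (a c d : Qp p)
    (ac_neq0 : a * c != 0) (d_sqrt : d ^+ 2 = c ^+ 2 - 4%:R * a)
    (r : rat) (r_pow : exists m : int, r = p%:R ^ m) :
  let xh1 := (- c + d) / 2%:R in
  let xh2 := (- c - d) / 2%:R in
  let f := ratmap a c xh1 xh2 in
  let x1 := 0 in
  let x2 := - c in
  let alpha := Num.min (Qp_norm xh1) (Qp_norm xh2) in
  let beta := Num.max (Qp_norm xh1) (Qp_norm xh2) in
  (invariant_sphere f r x1 <-> r < alpha) /\
  (invariant_sphere f r x2 <->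
     [/\ Qp_norm c < alpha, alpha = beta & r < alpha] \/
     [/\ Qp_norm c = alpha, alpha = beta,
         Qp_norm (a - c ^+ 2) = alpha ^+ 2 & r < alpha]).
Proof.
move=> u v f x1 x2 alpha beta.
have two0 : 2%:R != 0 :> Qp p by rewrite Qp_natr_eq0.
have cE : c = - (u + v).
  rewrite /u /v -mulrDl addrACA subrr addr0 -mulr2n.
  rewrite -[- c *+ 2]mulr_natr mulfK //.
  by rewrite opprK.
have aE : a = u * v.
  rewrite /u /v mulf_div; apply: (mulIf (mulf_neq0 two0 two0)).
  rewrite divfK ?mulf_neq0 //.
  have -> : (- c + d) * (- c - d) = c ^+ 2 - d ^+ 2 by ring.
  rewrite d_sqrt; ring.
rewrite /alpha /beta /f /x1 /x2 {f x1 x2 alpha beta}.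
clearbody u v; clear d d_sqrt two0; subst a c.
move: ac_neq0; rewrite mulf_eq0 negb_or mulf_eq0 negb_or.
move=> /andP[/andP[u0 v0] _].
rewrite opprK Qp_normN sqrrN.
wlog uv : u v u0 v0 / Qp_norm u <= Qp_norm v.
  move=> th; have /orP[uv|vu] := le_total (Qp_norm u) (Qp_norm v).
    exact: th.
  by rewrite ratmap_swap [u + v]addrC [u * v]mulrC minC maxC; exact: th.
rewrite min_l // max_r //; split; first exact: invariant_sphere_0.
rewrite invariant_sphere_uv //; split=> [[ru uvE kE]|].
  have : Qp_norm (u + v) <= Qp_norm u.
    by apply: le_trans (Qp_normD _ _) _; rewrite -uvE ge_max lexx.
  by rewrite le_eqVlt => /predU1P[cu|cu]; [right|left]; split.
case=> [[cu uvE ru]|[]] //; split=> //.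
rewrite Qp_normD_ltr Qp_normM -?uvE ?expr2 // Qp_normN Qp_normM.
by rewrite ltr_pM ?Qp_norm_ge0.
Qed.
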